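(* Let $G_0$ be a finite group, $S\subseteq G_0$ not containing the identity, and $\Gamma=\mathrm{Cay}(G_0,S)$. Let $G$ be an abelian subgroup of $G_0$ of index $n$, identified with $\mathbb{Z}_{d_1}\times\cdots\times\mathbb{Z}_{d_r}$, and let $N=|G|$. Let $\{s_1,\dots,s_n\}$ be a left transversal to $G$ in $G_0$, and for $i,j\in[n]$ set $S_{i,j}=\{g\in G: s_jgs_i^{-1}\in S\}$. Set $$H=\{\sigma\in\mathrm{Gal}(\mathbb{Q}(\omega_N)|\mathbb{Q}):\ \beta_k\langle\Delta\rangle(g)=\beta_k\langle\Delta\rangle(\eta_\sigma(g))\ \text{for all }k\in[n],\ g\in G\}$$ and $K_0=\mathrm{Inv}(H)$. Let $\{H_j:j\in J\}$ be the set of distinct orbits of $G$ under $H$ acting by $\sigma\cdot g=\eta_\sigma(g)$, and $\{v^{(j)}:j\in J\}$ a set of representatives, $v^{(j)}\in H_j$. Then the splitting field of $\Gamma$ is $$K_0\Big(\bigcup_{j\in J}\mathcal{R}\big(\mathcal{P}\langle\widetilde{\Delta}(\chi_{v^{(j)}})\rangle\big)\Big),$$ and $$\frac{\phi(N)}{|H|}\le\deg(\Gamma)\le(n!)^{|J|}\frac{\phi(N)}{|H|}.$$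
   Context: The Cayley digraph $\mathrm{Cay}(G_0,S)$ has vertex set $G_0$ and an arc from $g$ to $h$ whenever $hg^{-1}\in S$. The adjacency matrix has $(u,w)$ entry equal to the number of arcs from $u$ to $w$; the splitting field of a digraph is the splitting field over $\mathbb{Q}$ (inside $\mathbb{C}$) of the characteristic polynomial of its adjacency matrix, and $\deg(\Gamma)$ is its degree over $\mathbb{Q}$. $[n]=\{1,\dots,n\}$; $\omega_m=e^{2\pi\iota/m}$; $\phi$ is Euler's totient function. The abelian group $G$ is written additively. $\mathbb{Q}[G]$ is the ring of functions $G\to\mathbb{Q}$ with pointwise addition and convolution $(a*b)(g)=\sum_h a(g-h)b(h)$; $\delta_T$ is the indicator of $T\subseteq G$ and $-T=\{-t:t\in T\}$. $\Delta\in M_n(\mathbb{Q}[G])$ has $(i,j)$ entry $\delta_{-S_{j,i}}$. For a matrix $A$ over a commutative ring, $\beta_k\langle A\rangle$ is the sum of determinants of all $k\times k$ principal submatrices. For $\sigma\in\mathrm{Gal}(\mathbb{Q}(\omega_N)|\mathbb{Q})$, $l_\sigma\in\mathbb{Z}_N^*$ is given by $\sigma(\omega_N)=\omega_N^{l_\sigma}$ and $\eta_\sigma(g_1,\dots,g_r)=(l_\sigma g_1,\dots,l_\sigma g_r)$ (coordinate $i$ modulo $d_i$). $\mathrm{Inv}(H)=\{x\in\mathbb{Q}(\omega_N):\sigma(x)=x\ \forall\sigma\in H\}$. For $v\in G$, $\chi_v(g_1,\dots,g_r)=\prod_{i=1}^r\omega_{d_i}^{v_ig_i}$. $\widetilde{\Delta}(\chi)$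 is the complex $n\times n$ matrix with $(i,j)$ entry $\sum_{g\in S_{j,i}}\chi(g)$. $\mathcal{P}\langle M\rangle(x)=\det(xI_n-M)$ and $\mathcal{R}(f)$ is the set of distinct complex roots of $f$. *)

(* Defs.v *)
From HB Require Import structures.
From mathcomp Require Import all_boot all_order all_algebra all_fingroup.
From mathcomp Require Import all_field.

Set Implicit Arguments.
Unset Strict Implicit.
Unset Printing Implicit Defensive.

Import Order.TTheory GRing.Theory Num.Theory.
Local Open Scope ring_scope.

(* Subfields of the complex numbers.  Every number in play is algebraic, so   *)
(* [algC], the algebraic complex numbers, stands for the complex field.       *)

Definition is_subfield (F : algC -> Prop) : Prop :=
  [/\ F 1, forall x y, F x -> F y -> F (x - y)
    & forall x y, F x -> F y -> F (x / y)].

(* Q(A): the intersection of all subfields containing A.                      *)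
Definition adjoin (A : algC -> Prop) (x : algC) : Prop :=
  forall F : algC -> Prop, is_subfield F -> (forall a, A a -> F a) -> F x.

(* Q(s) as an abstract extension of Q, with its embedding [numfieldC] and the *)
(* preimages [numfield_gens s] of s.                                          *)
Definition numfield (s : seq algC) : fieldExtType rat :=
  projT1 (num_field_exists s).

Definition numfieldC (s : seq algC) : {rmorphism numfield s -> algC} :=
  projT1 (projT2 (num_field_exists s)).

Definition numfield_gens (s : seq algC) : seq (numfield s) :=
  s2val (projT2 (projT2 (num_field_exists s))).

Lemma numfield_gensC s : map (numfieldC s) (numfield_gens s) = s.
Proof. exact: (s2valP (projT2 (projT2 (num_field_exists s)))). Qed.

Lemma numfield_gens_full s : <<1 & numfield_gens s>>%VS = fullv.
Proof. exact: (s2valP' (projT2 (projT2 (num_field_exists s)))). Qed.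

Lemma subfield_fieldExt (L : fieldExtType rat) (iota : {rmorphism L -> algC})
  (F : algC -> Prop) (t : seq L) :
  is_subfield F -> (forall y, y \in t -> F (iota y)) ->
  forall y, y \in <<1 & t>>%VS -> F (iota y).
Proof.
move=> [F1 FB FV].
have F0 : F 0 by rewrite -(subrr 1); apply: FB.
have FN x : F x -> F (- x) by move=> Fx; rewrite -sub0r; apply: FB.
have FD x y : F x -> F y -> F (x + y).
  by move=> Fx Fy; rewrite -[y]opprK; apply: FB => //; apply: FN.
have FI x : F x -> F x^-1 by move=> Fx; rewrite -div1r; apply: FV.
have FM x y : F x -> F y -> F (x * y).
  by move=> Fx Fy; rewrite -[y]invrK; apply: FV => //; apply: FI.
have FX x k : F x -> F (x ^+ k).
  by move=> Fx; elim: k => [|k IHk]; rewrite ?expr0 // exprS; apply: FM.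
have Fnat k : F k%:R by elim: k => [|k IHk]; rewrite // -addn1 natrD; apply: FD.
have Fint (z : int) : F z%:~R.
  case: z => k; first by rewrite -pmulrn; apply: Fnat.
  by rewrite NegzE mulrNz; apply/FN/Fnat.
have Fsc (a : rat) : F (iota a%:A).
  by rewrite alg_num_field fmorph_rat /ratr; apply: FV.
elim/last_ind: t => [|t x IHt] Ft y.
  by rewrite adjoin_nil ?subfield_closed //= => /vlineP[a ->].
rewrite adjoin_rcons => /Fadjoin_polyP[p /polyOverP pt ->].
rewrite horner_coef rmorph_sum.
have Ft' z : z \in t -> F (iota z) by move=> tz; apply: Ft; rewrite mem_rcons inE tz orbT.
apply: (big_ind F) => // i _; rewrite rmorphM rmorphXn; apply: FM.
  exact: IHt Ft' _ (pt i).
by apply: FX; apply: Ft; rewrite mem_rcons mem_head.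
Qed.

Lemma numfieldP (s : seq algC) (x : algC) :
  adjoin (fun z => z \in s) x <-> exists y : numfield s, numfieldC s y = x.
Proof.
split=> [sx | [y <-] F Fsub Fs].
  apply: (sx (fun x => exists y, numfieldC s y = x)) => [|a].
    split=> [|_ _ [y <-] [z <-]|_ _ [y <-] [z <-]]; first by exists 1; rewrite rmorph1.
      by exists (y - z); rewrite rmorphB.
    by exists (y / z); rewrite fmorph_div.
  by rewrite -{1}(numfield_gensC s) => /mapP[y _ ->]; exists y.
apply: (@subfield_fieldExt _ _ F (numfield_gens s)) => // [z sz|].
  by apply: Fs; have := map_f (numfieldC s) sz; rewrite numfield_gensC.
by rewrite numfield_gens_full memvf.
Qed.

(* The splitting field of p in C, and its degree over Q.                      *)
Definition splitting_field (p : {poly rat}) : algC -> Prop :=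
  adjoin (fun z => root (map_poly ratr p) z).

Definition complex_roots (p : {poly rat}) : seq algC :=
  sval (closed_field_poly_normal (map_poly ratr p : {poly algC})).

Definition splitting_degree (p : {poly rat}) : nat :=
  \dim {: numfield (complex_roots p)}.

Lemma splitting_fieldP (p : {poly rat}) (x : algC) : p != 0 ->
  splitting_field p x <->
  exists y : numfield (complex_roots p), numfieldC _ y = x.
Proof.
move=> p0; apply: iff_trans (numfieldP _ _).
rewrite /splitting_field /complex_roots.
case: closed_field_poly_normal => rs /= Dp.
have rsE z : root (map_poly ratr p) z = (z \in rs).
  by rewrite Dp rootZ ?root_prod_XsubC // lead_coef_eq0 map_poly_eq0.
by split=> Hx F Fsub Fs; apply: Hx => // a; rewrite ?rsE => Ha; apply: Fs; rewrite ?rsE.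
Qed.

(* e^(2 pi i / m): [m.-root (-1)] has least argument among the m-th roots of  *)
(* -1 in the closed upper half-plane, so it is e^(pi i / m).                  *)
Definition omega (m : nat) : algC := (m.-root (-1)) ^+ 2.

Lemma omega_expn m : (0 < m)%N -> omega m ^+ m = 1.
Proof. by move=> m0; rewrite /omega exprAC rootCK // sqrrN expr1n. Qed.

Lemma cyclotomic_splitting N : splitting_field_axiom (numfield [:: omega N]).
Proof.
have := numfield_gensC [:: omega N]; have := numfield_gens_full [:: omega N].
case: (numfield_gens _) => [|w [|//]] //= genQ [Dw].
case: (posnP N) => [N0 | N0].
  exists 'X; first by rewrite polyOverX.
  exists [:: 0]; first by rewrite big_seq1 subr0 eqpxx.
  suff w0 : w = 0 by rewrite -w0.
  by apply: (fmorph_inj (numfieldC [:: omega N])); rewrite Dw rmorph0 N0 /omega root0C expr0n.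
have wN1 : w ^+ N = 1.
  apply: (fmorph_inj (numfieldC [:: omega N])).
  by rewrite rmorphXn rmorph1 [X in X ^+ _]Dw omega_expn.
have [m prim_w _] := prim_order_exists N0 wN1.
exists ('X^m - 1); first by rewrite rpredB ?rpred1 ?rpredX //= polyOverX.
pose r := codom (fun i : 'I_m => w ^+ i).
have Dr: 'X^m - 1 = \prod_(y <- r) ('X - y%:P).
  by rewrite -(factor_Xn_sub_1 prim_w) big_mkord big_image.
exists r; first by rewrite -Dr eqpxx.
apply/eqP; rewrite eqEsubv subvf -genQ adjoin_seqSr //; apply/allP=> /=.
by rewrite andbT -root_prod_XsubC -Dr; apply/unity_rootP/prim_expr_order.
Qed.

(* Q(omega_N), with its embedding into C and the preimage of omega_N.         *)
Definition cyclotomic_field (N : nat) : splittingFieldType rat :=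
  HB.pack_for (splittingFieldType rat) (numfield [:: omega N])
    (FieldExt_isSplittingField.Build rat (numfield [:: omega N])
       (cyclotomic_splitting N)).

Definition cyclotomicC (N : nat) : {rmorphism cyclotomic_field N -> algC} :=
  numfieldC [:: omega N].

Definition zeta (N : nat) : cyclotomic_field N :=
  head 0 (numfield_gens [:: omega N]).

Lemma zetaC N : cyclotomicC N (zeta N) = omega N.
Proof.
rewrite /zeta /cyclotomicC; have := numfield_gensC [:: omega N].
by case: (numfield_gens _) => [|w [|//]] //= [].
Qed.

(* The exponent l_sigma, as its representative in {0, ..., N - 1}.            *)
Definition cyclo_exp (N : nat) (sigma : gal_of {: cyclotomic_field N}) : nat :=
  oapp val 0%N [pick l : 'I_N | sigma (zeta N) == zeta N ^+ l].

(* Inv(H) as a subset of C.                                                   *)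
Definition Inv (N : nat) (H : {set gal_of {: cyclotomic_field N}}) (x : algC) : Prop :=
  exists2 y : cyclotomic_field N, y \in fixedField H & cyclotomicC N y = x.

(* Z_{d_1} x ... x Z_{d_r}, for positive d_i: (d i).-1.+1 is then d i, and    *)
(* this form gives 'I_(d i) its additive group structure even when d i = 1.   *)
Definition Zprod (r : nat) (d : 'I_r -> nat) : Type :=
  {dffun forall i : 'I_r, 'I_((d i).-1.+1)}.

Section ZprodTheory.
Variables (r : nat) (d : 'I_r -> nat).
Local Notation ZP := (Zprod d).

HB.instance Definition _ := Finite.on ZP.

Definition Zprod_fun (x : ZP) : forall i, 'I_((d i).-1.+1) :=
  fun_of_fin (x : {dffun forall i : 'I_r, 'I_((d i).-1.+1)}).
Definition Zprod_mk (f : forall i, 'I_((d i).-1.+1)) : ZP :=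
  [ffun i => f i] : {dffun forall i : 'I_r, 'I_((d i).-1.+1)}.

Lemma Zprod_mkE f i : Zprod_fun (Zprod_mk f) i = f i.
Proof. by rewrite /Zprod_fun ffunE. Qed.

Lemma Zprod_eqP (x y : ZP) : (forall i, Zprod_fun x i = Zprod_fun y i) -> x = y.
Proof. by move=> eq_xy; apply/ffunP. Qed.

Definition Zprod_zero : ZP := Zprod_mk (fun=> 0).
Definition Zprod_opp (x : ZP) : ZP := Zprod_mk (fun i => - Zprod_fun x i).
Definition Zprod_add (x y : ZP) : ZP :=
  Zprod_mk (fun i => Zprod_fun x i + Zprod_fun y i).

Fact Zprod_addA : associative Zprod_add.
Proof. by move=> x y z; apply: Zprod_eqP => i; rewrite !Zprod_mkE addrA. Qed.
Fact Zprod_addC : commutative Zprod_add.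
Proof. by move=> x y; apply: Zprod_eqP => i; rewrite !Zprod_mkE addrC. Qed.
Fact Zprod_add0 : left_id Zprod_zero Zprod_add.
Proof. by move=> x; apply: Zprod_eqP => i; rewrite !Zprod_mkE add0r. Qed.
Fact Zprod_addN : left_inverse Zprod_zero Zprod_opp Zprod_add.
Proof. by move=> x; apply: Zprod_eqP => i; rewrite !Zprod_mkE addNr. Qed.

HB.instance Definition _ :=
  GRing.isZmodule.Build ZP Zprod_addA Zprod_addC Zprod_add0 Zprod_addN.
End ZprodTheory.


(* The group algebra Q[A] of a finite abelian group, written additively: a    *)
(* new name for {ffun A -> rat}, so as to carry convolution and not the       *)
(* pointwise product.                                                         *)
Definition gralg (A : finZmodType) : Type := {ffun A -> rat}.

Section GroupAlgebra.
Variable A : finZmodType.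
Implicit Types a b c : gralg A.

HB.instance Definition _ := GRing.Zmodule.on (gralg A).

Definition gralg_fun a : A -> rat := fun_of_fin (a : {ffun A -> rat}).

Definition gralg_mk (f : A -> rat) : gralg A := [ffun g => f g].

Lemma gralg_mkE f g : gralg_fun (gralg_mk f) g = f g.
Proof. exact: ffunE. Qed.

Lemma gralgP a b : gralg_fun a =1 gralg_fun b <-> a = b.
Proof. exact: ffunP. Qed.

Lemma gralgD a b g : gralg_fun (a + b) g = gralg_fun a g + gralg_fun b g.
Proof. exact: ffunE. Qed.

Definition gralg_delta (T : {set A}) : gralg A := gralg_mk (fun g => (g \in T)%:R).

Definition gralg_mul a b : gralg A :=
  gralg_mk (fun g => \sum_(h : A) gralg_fun a (g - h) * gralg_fun b h).

Definition gralg_one : gralg A := gralg_delta [set 0].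

Fact gralg_mulC : commutative gralg_mul.
Proof.
move=> a b; apply/gralgP => g; rewrite !gralg_mkE.
have bij : bijective (fun h : A => g - h).
  by exists (fun h => g - h) => h; rewrite subKr.
rewrite (reindex _ (onW_bij _ bij)) /=; apply: eq_bigr => h _.
by rewrite subKr mulrC.
Qed.

Fact gralg_mulA : associative gralg_mul.
Proof.
move=> a b c; apply/gralgP => g; rewrite !gralg_mkE.
under eq_bigr => h _ do rewrite gralg_mkE big_distrr /=.
under [RHS]eq_bigr => h _ do rewrite gralg_mkE big_distrl /=.
rewrite exchange_big /=; apply: eq_bigr => k _.
have bij : bijective (fun h : A => h + k).
  by exists (fun h => h - k) => h; rewrite ?addrK ?subrK.
rewrite (reindex _ (onW_bij _ bij)) /=; apply: eq_bigr => h _.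
by rewrite addrK mulrA opprD [- h - k]addrC addrA.
Qed.

Fact gralg_mul1 : left_id gralg_one gralg_mul.
Proof.
move=> a; apply/gralgP => g; rewrite gralg_mkE (bigD1 g) //= big1 => [|h hg].
  by rewrite gralg_mkE subrr set11 mul1r addr0.
by rewrite gralg_mkE inE subr_eq0 eq_sym (negPf hg) mul0r.
Qed.

Fact gralg_mulD : left_distributive gralg_mul +%R.
Proof.
move=> a b c; apply/gralgP => g; rewrite gralgD !gralg_mkE -big_split /=.
by apply: eq_bigr => h _; rewrite gralgD mulrDl.
Qed.

Fact gralg_oner_neq0 : gralg_one != 0.
Proof.
apply/eqP => /gralgP/(_ 0); rewrite gralg_mkE set11 /gralg_fun ffunE.
by move/eqP; rewrite oner_eq0.
Qed.

HB.instance Definition _ := GRing.Zmodule_isComNzRing.Build (gralg A)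
  gralg_mulA gralg_mulC gralg_mul1 gralg_mulD gralg_oner_neq0.
End GroupAlgebra.

(* The sum of the k x k principal minors.                                     *)
Definition beta (R : comNzRingType) (n k : nat) (M : 'M[R]_n) : R :=
  \sum_(I : {set 'I_n} | #|I| == k)
    \det (\matrix_(i < #|I|, j < #|I|) M (enum_val i) (enum_val j)).

(* Cayley digraphs and adjacency matrices; a digraph on V without multiple    *)
(* arcs is a relation on V.                                                   *)
Definition Cay (G0 : finGroupType) (S : {set G0}) : rel G0 :=
  [rel g h | (h * g^-1)%g \in S].

Definition adjmx (V : finType) (arc : rel V) : 'M[rat]_#|V| :=
  \matrix_(u, w) (arc (enum_val u) (enum_val w))%:R.

(* e identifies Z_{d_1} x ... x Z_{d_r} with the subgroup G.                  *)
Definition identifies (G0 : finGroupType) (r : nat) (d : 'I_r -> nat)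
    (e : Zprod d -> G0) (G : {set G0}) : Prop :=
  [/\ injective e, {morph e : x y / x + y >-> (x * y)%g} & e @: setT = G].

Section Connection.
Variables (G0 : finGroupType) (n r : nat) (d : 'I_r -> nat).

(* S_{i,j}, as a subset of Z_{d_1} x ... x Z_{d_r}.                           *)
Definition connection_set (S : {set G0}) (e : Zprod d -> G0) (s : 'I_n -> G0)
    (i j : 'I_n) : {set Zprod d} :=
  [set g | (s j * e g * (s i)^-1)%g \in S].

Implicit Types (T : 'I_n -> 'I_n -> {set Zprod d}) (N : nat).

Definition Delta T : 'M[gralg (Zprod d)]_n :=
  \matrix_(i, j) gralg_delta [set - t | t in T j i].

Definition chi (v g : Zprod d) : algC :=
  \prod_(i < r) omega (d i) ^+ (Zprod_fun v i * Zprod_fun g i)%N.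

Definition Delta_tilde T (c : Zprod d -> algC) : 'M[algC]_n :=
  \matrix_(i, j) \sum_(g in T j i) c g.

Definition eta N (sigma : gal_of {: cyclotomic_field N}) (g : Zprod d) : Zprod d :=
  Zprod_mk (fun i => Zprod_fun g i *+ cyclo_exp sigma).

(* k : 'I_n stands for the index k + 1 in {1, ..., n}.                        *)
Definition H_group N T : {set gal_of {: cyclotomic_field N}} :=
  [set sigma in 'Gal({: cyclotomic_field N} / 1)%g |
    [forall k : 'I_n, forall g : Zprod d,
      gralg_fun (beta k.+1 (Delta T)) g ==
        gralg_fun (beta k.+1 (Delta T)) (eta sigma g)]].

Definition eta_orbits N (H : {set gal_of {: cyclotomic_field N}}) : {set {set Zprod d}} :=
  [set [set eta sigma g | sigma in H] | g in [set: Zprod d]].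
End Connection.

(* Main.v *)
Require Import Defs.
From HB Require Import structures.
From mathcomp Require Import all_boot all_order all_algebra all_fingroup.
From mathcomp Require Import all_field.
From mathcomp Require Import ring.

Set Implicit Arguments.
Unset Strict Implicit.
Unset Printing Implicit Defensive.

Import Order.TTheory GRing.Theory Num.Theory.
Local Open Scope ring_scope.

(* An eigenvector of the Cayley digraph, read on the coset decomposition       *)
(* G_0 = U_i s_i G and Fourier transformed along G, splits into eigenvectors   *)
(* of the n x n matrices Delta_tilde(chi_v); hence the eigenvalues of Gamma    *)
(* are the roots of the polynomials P_v = P<Delta_tilde(chi_v)>.  Up to sign,  *)
(* the coefficients of P_v are the values at v of the Fourier transforms of    *)
(* the beta_k<Delta>, and sigma in Gal(Q(omega_N)|Q) sends the value at v to   *)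
(* the value at eta_sigma(v).  By Fourier inversion, H is therefore the group  *)
(* fixing all these coefficients, so that K_0 is the field they generate, and  *)
(* P_v only depends on the H-orbit of v.  Since K_0 lies in the splitting      *)
(* field, [K_0 : Q] = phi(N) / |H| gives the lower bound; adjoining to K_0 the *)
(* roots of one polynomial of degree n per orbit gives the upper bound.        *)

(** The eigenvalue correspondence is [root_char_poly_Cay]; it rests on [transversal_bij] and on
    injectivity of the Fourier transform, hence on [omega_prim]. [char_poly_beta] and the
    multiplicativity of [fourier v] turn the coefficients of P_v into transforms of the beta_k.
    [H_group_Gal] shows that H is the whole Galois group over the field these generate, so the
    Galois correspondence gives back that field as K_0. Degrees are compared through images in C by
    [dimv_le_image], and [dim_adjoin_flatten_roots] bounds the tower of adjoined roots. *)

Lemma seq_max_real (T : eqType) (f : T -> algC) (s : seq T) :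
  (forall x, f x \is Num.real) -> s != [::] ->
  exists2 x, x \in s & forall y, y \in s -> f y <= f x.
Proof.
move=> f_real; elim: s => // a [_ _|b s IHs _].
  by exists a => [|y]; rewrite ?mem_head // inE => /eqP->.
have [//|x sx le_x] := IHs.
have [le_ax|/ltW le_xa] := real_leP (f_real a) (f_real x).
  exists x => [|y]; first by rewrite inE sx orbT.
  by rewrite inE => /predU1P[-> //|/le_x].
exists a => [|y]; first by rewrite mem_head.
by rewrite inE => /predU1P[-> //|/le_x/le_trans->].
Qed.

(* On the unit circle |z - 1|^2 = 2 - 2 Re z: dividing by w^2 brings x closer to 1. *)
Lemma Re_div_sqr_gt (x w : algC) :
    `|x| = 1 -> `|w| = 1 -> 0 <= 'Im x -> 0 < 'Im w -> 'Re x < 'Re w ->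
  'Re x < 'Re (x / w ^+ 2).
Proof.
move=> nx nw Ix0 Iw0 ltRe.
set a := 'Re w in ltRe *; set b := 'Im w in Iw0 *.
set c := 'Re x in ltRe *; set s := 'Im x in Ix0 *.
have /eqP := normC2_Re_Im w; rewrite nw expr1n -/a -/b => /eqP/esym w1.
have /eqP := normC2_Re_Im x; rewrite nx expr1n -/c -/s => /eqP/esym x1.
have b2E : b ^+ 2 = 1 - a ^+ 2 by rewrite -w1 addrC addKr.
have s2E : s ^+ 2 = 1 - c ^+ 2 by rewrite -x1 addrC addKr.
have ->: x / w ^+ 2 = (c + 'i * s) * (a - 'i * b) ^+ 2.
  rewrite /c /s -Crect invC_norm normrX nw !expr1n invr1 mul1r rmorphXn /=.
  by rewrite {1}[w]Crect conjC_rect // Creal_Re.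
have ->: (c + 'i * s) * (a - 'i * b) ^+ 2 =
   (c * (a ^+ 2 - b ^+ 2) + 2 * a * b * s) +
   'i * (s * (a ^+ 2 - b ^+ 2) - 2 * a * b * c).
  by have := sqrCi algC => i2; ring: i2.
have [Ra Rb Rc Rs] :
    [/\ a \is Num.real, b \is Num.real, c \is Num.real & s \is Num.real].
  by rewrite /a /b /c /s !Creal_Re !Creal_Im.
rewrite Re_rect; last 2 first.
- by rewrite rpredD ?rpredM ?rpredB ?rpredX ?realn.
- by rewrite rpredB ?rpredM ?rpredB ?rpredX ?realn.
(* By the unit circle relations, the difference of the real parts becomes a product of positive
   factors once multiplied by s + b > 0. *)
have sb0 : 0 < s + b by rewrite ltr_wpDl.
rewrite -subr_gt0 -(pmulr_lgt0 _ sb0).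
have ->: (c * (a ^+ 2 - b ^+ 2) + 2 * a * b * s - c) * (s + b) =
   b * (a - c) * ((a + c) ^+ 2 + (b + s) ^+ 2) by ring: b2E s2E.
rewrite !mulr_gt0 ?subr_gt0 //.
rewrite ltr_wpDl ?real_exprn_even_ge0 ?rpredD // exprn_gt0 //.
by rewrite addrC.
Qed.

(* The root w of least argument generates: otherwise some m-th root x of -1 in *)
(* the upper half-plane outside <w> has largest real part, and x / w^2, or its *)
(* conjugate, has a larger one.                                                *)
Lemma prim_rootCN1 m :
  (0 < m)%N -> (m * 2)%N.-primitive_root (m.-root (-1 : algC)).
Proof.
move=> m0; set w := m.-root (-1).
have wm : w ^+ m = -1 by rewrite /w rootCK.
have N1_neq1 : -1 != 1 :> algC by rewrite -subr_eq0 -opprD oppr_eq0 (pnatr_eq0 _ 2).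
have [k prim_w dv_k] : {k | k.-primitive_root w & (k %| m * 2)%N}.
  by apply: prim_order_exists; rewrite ?muln_gt0 ?m0 // exprM wm sqrrN expr1n.
have m2_gt0 : (0 < m * 2)%N by rewrite muln_gt0 m0.
have [z prim_z] := C_prim_root_exists m2_gt0.
have zm : z ^+ m = -1.
  have: (z ^+ m) ^+ 2 == 1 by rewrite -exprM (prim_expr_order prim_z).
  rewrite sqrf_eq1 -(prim_order_dvd prim_z) => /orP[/(dvdn_leq m0)|/eqP//].
  by rewrite muln2 -addnn -{3}[m]addn0 leq_add2l leqNgt m0.
suffices zk : z ^+ k = 1.
  suff -> : (m * 2)%N = k by [].
  by apply/eqP; rewrite eqn_dvd dv_k (prim_order_dvd prim_z) zk eqxx.
apply/eqP/negPn/negP => zk.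
(* For m = 1 the root w is -1, outside the open upper half-plane; there z = w settles the claim. *)
case: (ltngtP 1%N m) => [m1 | | m1]; last 2 first.
- by rewrite ltnS leqn0 eqn0Ngt m0.
- move: zk; have:= zm; rewrite -m1 expr1 -wm -m1 expr1 => ->.
  by rewrite (prim_expr_order prim_w) eqxx.
pose bad (x : algC) := [&& x ^+ m == -1, x ^+ k != 1 & 0 <= 'Im x].
have norm_m (x : algC) : x ^+ m = -1 -> `|x| = 1.
  move=> xm; apply: (pexpIrn m0); rewrite ?nnegrE ?normr_ge0 //.
  by rewrite -normrX xm expr1n normrN normr1.
have badJ (x : algC) : x ^+ m = -1 -> x ^+ k != 1 ->
    exists2 y : algC, bad y & 'Re y = 'Re x.
  move=> xm xk; have Rx : 'Im x \is Num.real by rewrite Creal_Im.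
  have [Ix|/ltW Ix] := real_leP (rpred0 _) Rx.
    by exists x; rewrite // /bad xm eqxx xk.
  exists x^*; last by rewrite Re_conj.
  rewrite /bad -!rmorphXn /= xm rmorphN rmorph1 eqxx Im_conj oppr_ge0 Ix andbT /=.
  by apply: contra xk => /eqP xk; rewrite -[_ ^+ k]conjCK xk rmorph1.
have [x0 bad0 _] := badJ z zm zk.
have badP x : bad x -> x \in [seq z ^+ i | i <- iota 0 (m * 2)].
  case/and3P=> /eqP xm _ _; have x1 : x ^+ (m * 2) = 1 by rewrite exprM xm sqrrN expr1n.
  have [i ->] := prim_rootP prim_z x1; apply/mapP; exists (i : nat) => //.
  by rewrite mem_iota /=.
pose s := filter bad [seq z ^+ i | i <- iota 0 (m * 2)].
have s0 : s != [::] by rewrite -has_filter; apply/hasP; exists x0; rewrite ?badP.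
have [x sx max_x] := seq_max_real (fun x => Creal_Re x) s0.
have badx : bad x by move: sx; rewrite mem_filter => /andP[].
have {sx} [/eqP xm xk Ix] := and3P badx.
have [nx nw] := (norm_m x xm, norm_m w wm).
have Iw : 0 <= 'Im w by rewrite Im_rootC_ge0.
have leRe : 'Re x <= 'Re w by rewrite rootC_Re_max.
have Iw0 : 0 < 'Im w.
  rewrite lt_def Iw andbT; apply/eqP => Iw0.
  have Rw : w \is Num.real by apply/Creal_ImP.
  have: w ^+ 2 == 1 by rewrite -(real_normK Rw) nw expr1n.
  rewrite sqrf_eq1 => /pred2P[w1|w1].
    by case/eqP: N1_neq1; apply: etrans (esym wm) _; rewrite w1 expr1n.
  by have := rootC_lt0 (-1 : algC) m1; rewrite -[m.-root _]/w w1 ltrN10.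
have neqRe : 'Re x != 'Re w.
  apply: contra xk => /eqP eqRe; apply/eqP.
  suff -> : x = w by apply: prim_expr_order.
  by apply: eqC_semipolar => //; rewrite ?nx ?nw // mulr_ge0.
have ltRe : 'Re x < 'Re w by rewrite lt_def eq_sym neqRe.
have := Re_div_sqr_gt nx nw Ix Iw0 ltRe.
have [|| y bady <-] := badJ (x / w ^+ 2).
- by rewrite expr_div_n xm exprAC wm sqrrN expr1n divr1.
- by rewrite expr_div_n exprAC (prim_expr_order prim_w) expr1n divr1.
by rewrite le_gtF // max_x // mem_filter bady badP.
Qed.

Lemma omega_prim m : (0 < m)%N -> m.-primitive_root (omega m).
Proof.
move=> m0; have := exp_prim_root (prim_rootCN1 m0) 2.
by rewrite gcdnMl mulnK.
Qed.

(** * Characteristic polynomials and principal minors *)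

(** Sylvester's identity: U V and V U are block triangular with determinants the two sides, and both
    determinants equal det V because det U = 1. *)
Lemma det_add1_mulC (R : comNzRingType) m n (A : 'M[R]_(m, n)) (B : 'M[R]_(n, m)) :
  \det (1%:M + A *m B) = \det (1%:M + B *m A).
Proof.
pose U := block_mx 1%:M (- A) 0 1%:M : 'M[R]_(m + n).
pose V := block_mx 1%:M A (- B) 1%:M : 'M[R]_(m + n).
have detU : \det U = 1 by rewrite det_ublock !det1 mulr1.
have UV : U *m V = block_mx (1%:M + A *m B) 0 (- B) 1%:M.
  rewrite mulmx_block !mul1mx !mul0mx !mulmx1 !add0r mulmxN mulNmx opprK.
  by rewrite addrN.
have VU : V *m U = block_mx 1%:M 0 (- B) (1%:M + B *m A).
  rewrite mulmx_block !mul1mx !mulmx0 !mulmx1 !addr0 mulmxN mulNmx opprK.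
  by rewrite addNr addrC.
have := congr1 determinant UV; rewrite det_mulmx detU mul1r det_lblock det1 mulr1 => <-.
have := congr1 determinant VU.
by rewrite det_mulmx detU mulr1 det_lblock det1 mul1r.
Qed.

Lemma det_principal_sub (R : comNzRingType) n (M : 'M[R]_n) (I : {set 'I_n}) :
  \det (\matrix_(i < #|I|, j < #|I|) M (enum_val i) (enum_val j)) =
  \det (\matrix_(i, j) if i \in I then M i j else (i == j)%:R).
Proof.
(* P selects the rows in I: the submatrix is P M P^T, while the matrix on the *)
(* right-hand side is 1 + P^T P (M - 1).                                      *)
pose P := \matrix_(i < #|I|, j < n) (enum_val i == j)%:R : 'M[R]_(#|I|, n).
have PM p (A : 'M[R]_(n, p)) i j : (P *m A) i j = A (enum_val i) j.
  rewrite mxE (bigD1 (enum_val i)) //= mxE eqxx mul1r big1 ?addr0 // => k ki.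
  by rewrite mxE eq_sym (negPf ki) mul0r.
have PtE p (A : 'M[R]_(#|I|, p)) i j :
    (P^T *m A) i j = \sum_(k | enum_val k == i) A k j.
  rewrite mxE [RHS]big_mkcond; apply: eq_bigr => k _.
  by rewrite !mxE; case: eqP; rewrite ?mul1r ?mul0r.
have MPt p (A : 'M[R]_(p, n)) i j : (A *m P^T) i j = A i (enum_val j).
  rewrite mxE (bigD1 (enum_val j)) //= !mxE eqxx mulr1 big1 ?addr0 // => k ki.
  by rewrite !mxE eq_sym (negPf ki) mulr0.
have -> : \matrix_(i < #|I|, j < #|I|) M (enum_val i) (enum_val j) =
    1%:M + (P *m (M - 1%:M)) *m P^T.
  apply/matrixP => i j; rewrite mxE [RHS]mxE MPt PM !mxE (inj_eq enum_val_inj).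
  by rewrite addrC subrK.
rewrite det_add1_mulC; congr (\det _); apply/matrixP => i j.
rewrite mxE PtE mxE [in RHS]mxE; case: ifPn => [Ii | notIi].
  rewrite (bigD1 (enum_rank_in Ii i)) ?enum_rankK_in //=.
  rewrite big1 => [|k /andP[/eqP Dk /negP[]]].
    by rewrite PM enum_rankK_in // !mxE addr0 addrC subrK.
  by rewrite -(inj_eq enum_val_inj) Dk enum_rankK_in.
rewrite big1 ?addr0 // => k /eqP Dk; case/negP: notIi.
by rewrite -Dk enum_valP.
Qed.

(** Expand each permutation term of det(X - M) over the set I of rows that contribute an entry of
    -M. The other rows contribute X on the diagonal, so I collects a power of X times the
    determinant of M with identity rows outside I, a principal minor by [det_principal_sub]. *)
Lemma char_poly_beta (R : comNzRingType) n (M : 'M[R]_n) :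
  char_poly M = \sum_(k < n.+1) ((-1) ^+ k * beta k M) *: 'X^(n - k).
Proof.
pose MI (I : {set 'I_n}) := \matrix_(i, j) if i \in I then M i j else (i == j)%:R.
have -> : char_poly M =
    \sum_(I : {set 'I_n}) ((-1) ^+ #|I| * \det (MI I)) *: 'X^(n - #|I|).
  rewrite /char_poly /determinant.
  under eq_bigr => s _.
    under eq_bigr => i _ do rewrite /char_poly_mx mxE mxE mxE mxE addrC.
    rewrite bigA_distr mulr_sumr.
  over.
  rewrite exchange_big /=; apply: eq_bigr => I _.
  rewrite -mul_polyC mulr_sumr rmorph_sum mulr_suml; apply: eq_bigr => s _.
  rewrite mulrCA.
  rewrite !rmorphM !rmorph_sign rmorph_prod -!mulrA; congr (_ * _).
  rewrite (bigID (mem I)) /= [in RHS](bigID (mem I)) /=.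
  rewrite [X in _ * X = _](eq_bigr (fun i => 'X * (i == s i)%:R)); last first.
    by move=> i /negPf->; case: eqP => _; rewrite ?mulr1n ?mulr0n ?mulr1 ?mulr0.
  rewrite big_split /= prodr_const.
  rewrite (eq_bigr (fun i => -1 * (M i (s i))%:P)) => [|i ->]; last by rewrite mulN1r.
  rewrite big_split /= prodr_const.
  rewrite -!mulrA; congr (_ * (_ * _)).
    by apply: eq_bigr => i Ii; rewrite !mxE Ii.
  rewrite mulrC; congr (_ * _); last first.
    by rewrite -[X in (X - _)%N](card_ord n) -(cardC I) addKn.
  by apply: eq_bigr => i /negPf Ii; rewrite !mxE Ii polyC_natr.
rewrite (partition_big (fun I : {set 'I_n} => inord #|I| : 'I_n.+1) predT) //=.
apply: eq_bigr => k _; rewrite mulr_sumr scaler_suml.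
have kE (I : {set 'I_n}) : (inord #|I| == k) = (#|I| == k).
  by rewrite -val_eqE /= inordK // ltnS -[X in (_ <= X)%N](card_ord n) max_card.
rewrite (eq_bigl _ _ kE); apply: eq_bigr => I /eqP kI.
by rewrite det_principal_sub kI.
Qed.

Lemma coef_char_poly (R : comNzRingType) n (M : 'M[R]_n) k : (k <= n)%N ->
  (char_poly M)`_(n - k) = (-1) ^+ k * beta k M.
Proof.
move=> le_kn; rewrite char_poly_beta coef_sum.
have kn : (k < n.+1)%N by [].
rewrite (bigD1 (Ordinal kn)) // [X in _ + X = _]big1 => [|j neq_jk].
  by rewrite addr0 coefZ coefXn eqxx mulr1.
rewrite coefZ coefXn eqn_sub2lE ?leq_ord // -[k]/(val (Ordinal kn)) val_eqE.
by rewrite eq_sym (negPf neq_jk) mulr0.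
Qed.

(** * Characters of Z_{d_1} x ... x Z_{d_r} and the Fourier transform *)

Section Characters.
Variables (r : nat) (d : 'I_r -> nat).
Hypothesis d_gt0 : forall i, (0 < d i)%N.
Local Notation A := (Zprod d).

Lemma Zprod_funMn (g : A) l i : Zprod_fun (g *+ l) i = Zprod_fun g i *+ l.
Proof.
elim: l => [|l IHl]; first by rewrite !mulr0n Zprod_mkE.
by rewrite !mulrS Zprod_mkE IHl.
Qed.

Lemma omega_expX_expn i m : (omega (d i) ^+ m) ^+ (d i).-1.+1 = 1.
Proof. by rewrite prednK // exprAC omega_expn // expr1n. Qed.

Lemma chiC (v g : A) : chi v g = chi g v.
Proof. by apply: eq_bigr => i _; rewrite mulnC. Qed.

Lemma chiD (v g h : A) : chi v (g + h) = chi v g * chi v h.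
Proof.
rewrite -big_split; apply: eq_bigr => i _ /=.
by rewrite Zprod_mkE /= exprM expr_mod ?omega_expX_expn // exprD -!exprM.
Qed.

Lemma chi0 (v : A) : chi v 0 = 1.
Proof. by apply: big1 => i _; rewrite Zprod_mkE muln0. Qed.

Lemma chiMn (v g : A) l : chi v (g *+ l) = chi v g ^+ l.
Proof. by elim: l => [|l IHl]; rewrite ?chi0 // mulrS exprS chiD IHl. Qed.

Lemma chiMnl (v g : A) l : chi (v *+ l) g = chi v g ^+ l.
Proof. by rewrite chiC chiMn chiC. Qed.

Lemma chiN (v g : A) : chi v (- g) = chi (- v) g.
Proof.
have inv_g : chi v (- g) * chi v g = 1 by rewrite -chiD addNr chi0.
apply: (@mulIf _ (chi v g)).
  by apply/eqP=> g0; move/eqP: inv_g; rewrite g0 mulr0 eq_sym oner_eq0.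
by rewrite inv_g (chiC (- v)) (chiC v) -chiD addNr chi0.
Qed.

Lemma chi_nondegenerate (g : A) : g != 0 -> exists v : A, chi v g != 1.
Proof.
move=> g0; have [i gi0] : exists i, Zprod_fun g i != 0.
  apply/existsP; apply: contraR g0; rewrite negb_exists => /forallP g0.
  by apply/eqP/Zprod_eqP => i; apply/eqP; rewrite Zprod_mkE -[_ == _]negbK g0.
(* The i-th unit vector: its character takes the value omega_{d_i}^{g_i} at g, and 0 < g_i < d_i. *)
exists (Zprod_mk (fun j => inZp (j == i))).
rewrite /chi (bigD1 i) //= big1 => [|j /negPf ji]; last first.
  by rewrite Zprod_mkE ji /= mod0n.
rewrite Zprod_mkE eqxx mulr1 mulnC exprM /= expr_mod ?omega_expX_expn // expr1.
rewrite -(prim_order_dvd (omega_prim (d_gt0 i))) gtnNdvd ?lt0n //.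
by rewrite -[X in (_ < X)%N](prednK (d_gt0 i)).
Qed.

(** For g nonzero, translating v by some w with chi_w(g) <> 1 multiplies the sum by that value and
    also leaves it unchanged. *)
Lemma chi_orthogonal (g : A) : \sum_v chi v g = if g == 0 then #|{: A}|%:R else 0.
Proof.
case: eqVneq => [-> | /chi_nondegenerate[w]].
  by rewrite (eq_bigr (fun=> 1)) ?sumr_const // => v _; rewrite chi0.
apply: contraNeq => Snz; apply/eqP/(mulIf Snz); rewrite mul1r mulr_sumr.
rewrite [RHS](reindex_inj (addrI w)) /=; apply: eq_bigr => v _.
by rewrite chiC (chiC v) (chiC (w + v)) chiD.
Qed.

Lemma chi_inversion (u : A -> algC) g :
  \sum_v (\sum_h u h * chi v h) * chi v (- g) = #|{: A}|%:R * u g.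
Proof.
under eq_bigr => v _ do rewrite mulr_suml.
rewrite exchange_big /= (bigD1 g) //= [X in _ + X = _]big1 => [|h hg].
  under eq_bigr => v _ do rewrite -mulrA -chiD subrr chi0 mulr1.
  by rewrite sumr_const addr0 mulr_natl cardT -cardE.
under eq_bigr => v _ do rewrite -mulrA -chiD.
by rewrite -mulr_sumr chi_orthogonal subr_eq0 (negPf hg) mulr0.
Qed.

Lemma chi_sum_inj (u w : A -> algC) :
  (forall v, \sum_h u h * chi v h = \sum_h w h * chi v h) -> u =1 w.
Proof.
move=> eq_uw g; have A0 : #|{: A}|%:R != 0 :> algC.
  by rewrite pnatr_eq0 -lt0n; apply/card_gt0P; exists g.
apply: (mulfI A0); rewrite -!chi_inversion.
by apply: eq_bigr => v _; rewrite eq_uw.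
Qed.

(* With this sign convention the indicator of -T is sent to the sum of the *)
(* values of [chi v] on T.                                                 *)
Definition fourier (v : A) (a : gralg A) : algC :=
  \sum_g ratr (gralg_fun a g) * chi v (- g).

Lemma fourier_inj (a b : gralg A) :
  (forall v, fourier v a = fourier v b) -> a = b.
Proof.
move=> eq_ab; apply/gralgP => g; apply: (fmorph_inj (ratr : {rmorphism rat -> algC})).
apply: (@chi_sum_inj (ratr \o gralg_fun a) (ratr \o gralg_fun b)) => v.
(* Evaluating at -v undoes the sign in [fourier]. *)
have := eq_ab (- v); rewrite /fourier /=.
under eq_bigr => h _ do rewrite -chiN opprK.
by under [X in _ = X -> _]eq_bigr => h _ do rewrite -chiN opprK.
Qed.

Lemma fourier_zmod_morphism v : zmod_morphism (fourier v).
Proof.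
move=> a b; rewrite -sumrB; apply: eq_bigr => g _.
by rewrite -mulrBl -rmorphB /gralg_fun !ffunE.
Qed.

Lemma fourier_monoid_morphism v : monoid_morphism (fourier v).
Proof.
split=> [|a b].
  rewrite /fourier (bigD1 0) //= gralg_mkE set11 oppr0 chi0 mulr1 rmorph1.
  rewrite big1 ?addr0 // => g g0.
  by rewrite gralg_mkE inE (negPf g0) rmorph0 mul0r.
rewrite /fourier mulr_suml.
under eq_bigr => g _ do rewrite gralg_mkE rmorph_sum mulr_suml.
rewrite exchange_big /=.
under [RHS]eq_bigr => g _ do rewrite mulr_sumr.
rewrite [RHS]exchange_big /=; apply: eq_bigr => h _.
rewrite (reindex_inj (addIr h)) /=; apply: eq_bigr => g _.
by rewrite addrK rmorphM opprD chiD mulrACA.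
Qed.

(** [fourier v] turns convolution into product, so it is a ring morphism and commutes with
    determinants. *)
Lemma fourier_beta v n (M : 'M[gralg A]_n) k :
  fourier v (beta k M) = beta k (map_mx (fourier v) M).
Proof.
pose phiA := GRing.isZmodMorphism.Build _ _ _ (fourier_zmod_morphism v).
pose phiM := GRing.isMonoidMorphism.Build _ _ _ (fourier_monoid_morphism v).
pose phi : {rmorphism gralg A -> algC} := HB.pack (fourier v) phiA phiM.
rewrite -[fourier v]/(phi : _ -> _) /beta rmorph_sum; apply: eq_bigr => I _.
rewrite -det_map_mx; congr (\det _); apply/matrixP => i j.
by rewrite !mxE.
Qed.

Lemma fourier_Delta v n (T : 'I_n -> 'I_n -> {set A}) :
  map_mx (fourier v) (Delta T) = Delta_tilde T (chi v).
Proof.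
apply/matrixP => i j; rewrite !mxE /fourier (reindex_inj oppr_inj) /=.
rewrite [RHS]big_mkcond; apply: eq_bigr => g _; rewrite gralg_mkE opprK.
rewrite (mem_imset _ _ oppr_inj); case: (_ \in _).
  by rewrite rmorph1 mul1r.
by rewrite rmorph0 mul0r.
Qed.

Lemma coef_char_poly_Delta_tilde n (T : 'I_n -> 'I_n -> {set A}) v k :
  (k <= n)%N -> (char_poly (Delta_tilde T (chi v)))`_(n - k) =
                (-1) ^+ k * fourier v (beta k (Delta T)).
Proof. by move=> le_kn; rewrite coef_char_poly // fourier_beta fourier_Delta. Qed.

End Characters.

(** * The spectrum of the Cayley digraph *)

Lemma char_poly_tr (R : comNzRingType) n (M : 'M[R]_n) : char_poly M^T = char_poly M.
Proof.
rewrite /char_poly -det_tr; congr (\det _); apply/matrixP => i j.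
by rewrite !mxE eq_sym.
Qed.

Lemma root_char_poly_adjmx (V : finType) (arc : rel V) (y : algC) :
  root (map_poly ratr (char_poly (adjmx arc))) y <->
  exists2 f : V -> algC,
    forall h, \sum_g f g * (arc g h)%:R = y * f h & exists g, f g != 0.
Proof.
rewrite map_char_poly -eigenvalue_root_char; split.
  case/eigenvalueP => u uA u0; exists (fun g => u 0 (enum_rank g)).
    move=> h; have := congr1 (fun w : 'rV_#|V| => w 0 (enum_rank h)) uA.
    rewrite !mxE => <-.
    rewrite (reindex (@enum_val V V)) /=; last exact/onW_bij/enum_val_bij.
    by apply: eq_bigr => i _; rewrite !mxE ratr_nat enum_valK enum_rankK.
  apply/existsP; apply: contraR u0; rewrite negb_exists => /forallP u0.
  apply/eqP/rowP => i; rewrite mxE -[i]enum_valK.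
  by apply/eqP; rewrite -[_ == _]negbK u0.
case=> f fA [g fg]; apply/eigenvalueP; exists (\row_i f (enum_val i)).
  apply/rowP => j; rewrite !mxE -fA.
  rewrite [RHS](reindex (@enum_val V V)) /=; last exact/onW_bij/enum_val_bij.
  by apply: eq_bigr => i _; rewrite !mxE ratr_nat.
apply: contra fg => /eqP/rowP/(_ (enum_rank g)).
by rewrite !mxE enum_rankK => ->.
Qed.

(** Right eigenvectors here, left ones in [root_char_poly_adjmx]: the (j, i) entry of [Delta_tilde]
    sums over S_{i,j}, which records the arcs from coset i to coset j. *)
Lemma root_char_polyP n (M : 'M[algC]_n) y :
  root (char_poly M) y <->
  exists2 w : 'I_n -> algC,
    forall j, \sum_i w i * M j i = y * w j & exists i, w i != 0.
Proof.
rewrite -char_poly_tr -eigenvalue_root_char; split.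
  case/eigenvalueP => u uM u0; exists (u 0).
    move=> j; have := congr1 (fun w : 'rV_n => w 0 j) uM.
    by rewrite !mxE => <-; apply: eq_bigr => i _; rewrite mxE.
  apply/existsP; apply: contraR u0; rewrite negb_exists => /forallP u0.
  by apply/eqP/rowP => i; rewrite mxE; apply/eqP; rewrite -[_ == _]negbK u0.
case=> w wM [i wi]; apply/eigenvalueP; exists (\row_i w i).
  by apply/rowP => j; rewrite !mxE -wM; apply: eq_bigr => k _; rewrite !mxE.
by apply: contra wi => /eqP/rowP/(_ i); rewrite !mxE => ->.
Qed.

Section CayleySpectrum.
Variables (G0 : finGroupType) (S : {set G0}) (G : {group G0}) (n : nat).
Hypothesis indexG : #|[set: G0] : G|%g = n.
Variables (r : nat) (d : 'I_r -> nat).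
Hypothesis d_gt0 : forall i, (0 < d i)%N.
Variable e : Zprod d -> G0.
Hypothesis he : identifies e G.
Variable s : 'I_n -> G0.
Hypothesis hs :
  is_transversal [set s i | i : 'I_n] (lcosets G [set: G0]) [set: G0].
Local Notation T := (connection_set S e s).

Lemma identifies0 : e 0 = 1%g.
Proof. by have [_ eD _] := he; apply: (mulgI (e 0)); rewrite -eD addr0 mulg1. Qed.

Lemma identifiesN x : e (- x) = (e x)^-1%g.
Proof.
have [_ eD _] := he.
by apply/eqP; rewrite eq_sym eq_invg_mul -eD subrr identifies0.
Qed.

Lemma identifies_card : #|{: Zprod d}| = #|G|.
Proof. by have [e_inj _ <-] := he; rewrite card_imset // cardsT. Qed.

Lemma identifies_exponent (x : Zprod d) : x *+ #|G| = 0.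
Proof.
have [e_inj eD Ge] := he; apply: e_inj; rewrite identifies0.
have sxG : <[e x]>%g \subset G by rewrite cycle_subG -Ge imset_f.
transitivity (e x ^+ #|G|)%g; last first.
  by have /dvdnP[k ->] := cardSg sxG; rewrite mulnC expgM expg_order expg1n.
elim: #|G| => [|k IHk]; first exact: identifies0.
by rewrite mulrS eD IHk expgS.
Qed.

(** If s_i a = s_j b, then s_i and s_j share a left coset of G, which the transversal meets once;
    surjectivity follows by counting, as n |G| = |G_0|. *)
Lemma transversal_bij : bijective (fun x : 'I_n * Zprod d => (s x.1 * e x.2)%g).
Proof.
have [e_inj eD Ge] := he; have /and3P[partG sX /forall_inP X1] := hs.
have card_lG : #|lcosets G [set: G0]| = n.
  by rewrite -indexG card_lcosets.
have s_inj : injective s.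
  apply/injectiveP; rewrite -[injectiveb s]/(dinjectiveb _ _).
  have /imset_injP sI : #|[set s i | i : 'I_n]| == #|'I_n|.
    by rewrite (card_transversal hs) card_lG card_ord.
  by apply/injectiveP => i j; apply: sI.
have Ge_in x : e x \in G by rewrite -Ge imset_f.
apply: inj_card_bij; last first.
  by rewrite card_prod card_ord identifies_card -indexG -cardsT mulnC Lagrange ?subsetT.
move=> [i a] [j b] /= eq_ij; suff ij : i = j.
  by move: eq_ij; rewrite ij => /mulgI/e_inj->.
apply: s_inj; have /cards1P[c Dc] := X1 _ (imset_f (lcoset G) (in_setT (s i))).
have mem_c x : x \in [set s i | i : 'I_n] -> x \in lcoset G (s i) -> x = c.
  by move=> sx Gx; apply/set1P; rewrite -Dc inE sx.
rewrite (mem_c (s i)) ?imset_f ?lcosetE ?lcoset_refl //.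
rewrite (mem_c (s j)) ?imset_f ?lcosetE // mem_lcoset.
have -> : ((s i)^-1 * s j = e a * (e b)^-1)%g.
  by apply: (mulgI (s i)); rewrite mulKVg mulgA eq_ij mulgK.
by rewrite groupM ?groupV.
Qed.

Lemma Cay_transversal i j a b :
  Cay S (s i * e a)%g (s j * e b)%g = (b - a \in T i j).
Proof.
by have [_ eD _] := he; rewrite inE eD identifiesN /Cay /= invgM !mulgA.
Qed.

(** An eigenvector f yields w_i = sum_a f(s_i a) chi_v(a), nonzero for some v and i by injectivity
    of the transform; convolution with the indicator of a connection set becomes multiplication by
    an entry of [Delta_tilde]. Conversely, w extends to f(s_i a) = w_i chi_v(-a). *)
Lemma root_char_poly_Cay y :
  root (map_poly ratr (char_poly (adjmx (Cay S)))) y <->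
  exists v, root (char_poly (Delta_tilde T (chi v))) y.
Proof.
have [ge geK geK'] := transversal_bij.
have sumE (F : G0 -> algC) : \sum_g F g = \sum_i \sum_a F (s i * e a)%g.
  rewrite (reindex (fun x => s x.1 * e x.2)%g) /=; last exact/onW_bij/transversal_bij.
  by rewrite pair_bigA.
have sumT (c : Zprod d -> algC) i j b :
    \sum_a c (b + a) * (a \in T i j)%:R = \sum_(t in T i j) c (b + t).
  rewrite [RHS]big_mkcond; apply: eq_bigr => a _.
  by case: (_ \in _); rewrite ?mulr1 ?mulr0.
split=> [/root_char_poly_adjmx[f fA [g fg]] | [v /root_char_polyP[w wD [i wi]]]].
  pose w v i := \sum_a f (s i * e a)%g * chi v a.
  have /existsP[v /existsP[i wvi]] : [exists v, exists i, w v i != 0].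
    apply: contraR fg => /existsPn w0; move: (ge g) (geK' g) => [i a] /= <-.
    apply/eqP; apply: (@chi_sum_inj _ _ d_gt0 (fun a => f (s i * e a)%g) (fun=> 0)) => v.
    rewrite [RHS]big1 => [|b _]; last by rewrite mul0r.
    by have /existsPn/(_ i) := w0 v; rewrite negbK => /eqP.
  exists v; apply/root_char_polyP; exists (w v); last by exists i.
  move=> {wvi} {}i; rewrite /w mulr_sumr.
  under [RHS]eq_bigr => b _ do rewrite mulrA -fA sumE mulr_suml.
  rewrite exchange_big /=; apply: eq_bigr => j _.
  rewrite mxE mulr_suml.
  under [RHS]eq_bigr => b _ do rewrite mulr_suml.
  rewrite exchange_big /=; apply: eq_bigr => a _.
  rewrite -mulrA; under [RHS]eq_bigr => b _ do rewrite Cay_transversal -mulrA.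
  rewrite -mulr_sumr; congr (_ * _).
  rewrite mulr_sumr; under eq_bigr => b _ do rewrite -(chiD d_gt0).
  rewrite -(sumT (chi v)) [RHS](reindex_inj (addrI a)) /=.
  by apply: eq_bigr => b _; rewrite (addrC a) addrK mulrC.
apply/root_char_poly_adjmx.
exists (fun g => w (ge g).1 * chi v (- (ge g).2)); last first.
  exists (s i * e 0)%g; rewrite (geK (i, 0)) oppr0 chi0 mulr1 //.
move=> h; move: (ge h) (geK' h) => [j b] /= <-.
rewrite sumE mulrA -wD mulr_suml; apply: eq_bigr => k _.
under eq_bigr => a _ do rewrite (geK (k, a)) Cay_transversal /= -mulrA.
rewrite -mulr_sumr mxE -mulrA; congr (_ * _).
rewrite mulr_suml; under [RHS]eq_bigr => t _ do rewrite -(chiD d_gt0) addrC.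
rewrite -(sumT (chi v)) (reindex_inj (addrI b)) /= (reindex_inj oppr_inj) /=.
by apply: eq_bigr => a _; rewrite subKr opprB (addrC a).
Qed.

End CayleySpectrum.

(** * Subfields of C and degrees of extensions *)

Lemma subfieldM (F : algC -> Prop) x y : is_subfield F -> F x -> F y -> F (x * y).
Proof.
case=> F1 _ FV Fx Fy; rewrite -[y]invrK; apply: (FV) => //.
by rewrite -div1r; apply: FV.
Qed.

Lemma subfield_coef_prod_XsubC (F : algC -> Prop) (rs : seq algC) i :
  is_subfield F -> (forall z, z \in rs -> F z) -> F (\prod_(z <- rs) ('X - z%:P))`_i.
Proof.
move=> Fsub; have [F1 FB _] := Fsub.
have F0 : F 0 by rewrite -(subrr 1); apply: FB.
elim: rs i => [|z rs IHrs] i Frs.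
  by rewrite big_nil coef1; case: eqP.
have {}IHrs j := IHrs j (fun y rs_y => Frs y (mem_behead (s := z :: rs) rs_y)).
rewrite big_cons mulrBl coefB coefXM coefCM; apply: FB; first by case: eqP.
by apply: subfieldM => //; apply: Frs; rewrite mem_head.
Qed.

Lemma subfield_image (L : fieldExtType rat) (iota : {rmorphism L -> algC})
  (K : {subfield L}) : is_subfield (fun x => exists2 y, y \in K & iota y = x).
Proof.
split=> [|_ _ [x Kx <-] [y Ky <-]|_ _ [x Kx <-] [y Ky <-]].
- by exists 1; rewrite ?rpred1 ?rmorph1.
- by exists (x - y); rewrite ?rpredB ?rmorphB.
- by exists (x / y); rewrite ?rpred_div ?fmorph_div.
Qed.

Lemma adjoin_mono (A B : algC -> Prop) x :
  (forall a, A a -> adjoin B a) -> adjoin A x -> adjoin B x.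
Proof. by move=> AB Ax F Fsub FB; apply: Ax => // a /AB; apply. Qed.

(** Compares spaces living in different abstract fields: both embeddings are Q-linear, so a basis of
    [V1] carries over to a free family in [V2]. *)
Lemma dimv_le_image (L1 L2 : fieldExtType rat) (i1 : {rmorphism L1 -> algC})
    (i2 : {rmorphism L2 -> algC}) (V1 : {vspace L1}) (V2 : {vspace L2}) :
  (forall x, x \in V1 -> exists2 y, y \in V2 & i2 y = i1 x) -> (\dim V1 <= \dim V2)%N.
Proof.
move=> V12; have scaleE (L : fieldExtType rat) (i : {rmorphism L -> algC}) a x :
    i (a *: x) = ratr a * i x.
  by rewrite -mulr_algl rmorphM alg_num_field fmorph_rat.
have V1_basis (j : 'I_(\dim V1)) : (vbasis V1)`_j \in V1.
  by rewrite vbasis_mem // mem_nth // size_tuple.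
have [y V2y yE] := fin_all_exists2 (fun j => V12 _ (V1_basis j)).
pose Y := [tuple y j | j < \dim V1].
have freeY : free Y.
  apply/freeP => k Yk0; have /freeP := basis_free (vbasisP V1); apply.
  apply: (fmorph_inj i1); rewrite rmorph0 -(rmorph0 i2) -Yk0 !rmorph_sum.
  by apply: eq_bigr => j _; rewrite !scaleE -yE -tnth_nth tnth_mktuple.
rewrite -[\dim V1](size_tuple Y) -(eqP freeY) dimvS //.
by apply/span_subvP => _ /mapP[j _ ->].
Qed.

(** Adjoining one root x multiplies the degree by at most the number of roots; the others are the
    roots of the quotient by X - x, a polynomial over K(x). *)
Lemma dim_adjoin_roots (F0 : fieldType) (L : fieldExtType F0) (K : {subfield L})
    (rs : seq L) :
    \prod_(x <- rs) ('X - x%:P) \is a polyOver K ->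
  (\dim <<K & rs>> <= (size rs)`! * \dim K)%N.
Proof.
elim: rs K => [|x rs IHrs] K Kp; first by rewrite adjoin_nil subfield_closed mul1n.
rewrite adjoin_cons.
have Kx_p : \prod_(x <- rs) ('X - x%:P) \is a polyOver <<K; x>>%VS.
  rewrite -[\prod_(_ <- _) _](mulKp _ (negbT (polyXsubC_eq0 x))).
  have /(polyOverSv (subv_adjoin _ x)) := Kp; rewrite big_cons => Kxp.
  rewrite divp_polyOver //.
  by rewrite polyOverXsubC memv_adjoin.
apply: leq_trans (IHrs _ Kx_p) _.
rewrite factS (mulnC _.+1) -mulnA leq_mul2l dim_Fadjoin leq_mul2r.
rewrite -ltnS -size_minPoly -(size_prod_XsubC (x :: rs) id).
apply/orP; right; apply/orP; right; apply: dvdp_leq.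
  by rewrite monic_neq0 ?monic_prod_XsubC.
by rewrite minPoly_dvdp // root_prod_XsubC mem_head.
Qed.

Lemma dim_adjoin_flatten_roots (F0 : fieldType) (L : fieldExtType F0) (K : {subfield L})
    n (rss : seq (seq L)) :
    (forall rs, rs \in rss ->
       \prod_(x <- rs) ('X - x%:P) \is a polyOver K /\ size rs = n) ->
  (\dim <<K & flatten rss>> <= n`! ^ size rss * \dim K)%N.
Proof.
have adjoin_cat (V : {subfield L}) s1 s2 : (<<V & s1 ++ s2>> = <<<<V & s1>> & s2>>)%VS.
  elim: s1 V => [|x s1 IHs] V; first by rewrite adjoin_nil subfield_closed.
  by rewrite /= !adjoin_cons IHs.
elim: rss K => [|rs rss IHrss] K rssP; first by rewrite adjoin_nil subfield_closed mul1n.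
have [Krs sz_rs] := rssP rs (mem_head _ _).
rewrite /= adjoin_cat; apply: leq_trans (IHrss _ _) _.
  move=> rs1 rss_rs1; have [K1 sz1] := rssP rs1 (mem_behead (s := rs :: rss) rss_rs1).
  by split=> //; apply: polyOverSv K1; apply: subv_adjoin_seq.
by rewrite expnS (mulnC n`!) -mulnA leq_mul2l -sz_rs dim_adjoin_roots ?orbT.
Qed.

(** * The cyclotomic field and its Galois action *)

Lemma zeta_prim N : (0 < N)%N -> N.-primitive_root (zeta N).
Proof.
by move=> N0; rewrite -(fmorph_primitive_root (cyclotomicC N)) zetaC omega_prim.
Qed.

Lemma dim_cyclotomic_field N : (0 < N)%N -> \dim {: cyclotomic_field N} = totient N.
Proof.
move=> N0; have -> : {: cyclotomic_field N}%VS = <<1; zeta N>>%VS.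
  have := numfield_gens_full [:: omega N]; have := numfield_gensC [:: omega N].
  rewrite /zeta; case: numfield_gens => [|w [|//]] //= _ <-.
  by rewrite adjoin_seq1.
rewrite dim_Fadjoin dimv1 muln1.
have [p [Dp mon_p] dv_p] := minCpolyP (omega N).
have sz_p : size p = (totient N).+1.
  by rewrite -(size_map_poly (ratr : {rmorphism rat -> algC})) -Dp
             (minCpoly_cyclotomic (omega_prim N0)) size_cyclotomic.
have rootE (q : {poly rat}) :
    root (map_poly (in_alg (cyclotomic_field N)) q) (zeta N) = (p %| q)%R.
  rewrite -dv_p -(fmorph_root (cyclotomicC N)) zetaC -map_poly_comp.
  congr (root _ _); apply: eq_map_poly => a /=.
  by rewrite alg_num_field fmorph_rat.
apply/eqP; rewrite -eqSS -size_minPoly -sz_p eqn_leq; apply/andP; split.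
  rewrite -(size_map_poly (in_alg (cyclotomic_field N)) p); apply: dvdp_leq.
    by rewrite map_poly_eq0 monic_neq0.
  apply: minPoly_dvdp; last by rewrite rootE.
  by apply/polyOverP => i; rewrite coef_map /= rpredZ ?rpred1.
(* The minimal polynomial over the prime subfield descends to Q[X], where it is comparable with the
   cyclotomic polynomial. *)
have [q Dq] : exists q, minPoly 1 (zeta N) = map_poly (in_alg (cyclotomic_field N)) q.
  have aP i : (minPoly 1 (zeta N))`_i \in 1%VS by apply/polyOverP/minPolyOver.
  have a_ i := sig_eqW (vlineP _ _ (aP i)).
  exists (\poly_(i < size (minPoly 1 (zeta N))) sval (a_ i)).
  apply/polyP=> i; rewrite coef_map coef_poly /=.
  case: ltnP => [_|le_i]; first by case: (a_ i).
  by rewrite scale0r nth_default.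
rewrite Dq size_map_poly dvdp_leq //; last by rewrite -rootE -Dq root_minPoly.
by rewrite -(map_poly_eq0 (in_alg (cyclotomic_field N))) -Dq monic_neq0 ?monic_minPoly.
Qed.

Section GaloisAction.
Variables (N r : nat) (d : 'I_r -> nat).
Hypothesis N_gt0 : (0 < N)%N.
Hypothesis d_gt0 : forall i, (0 < d i)%N.
Local Notation A := (Zprod d).
Hypothesis expA : forall x : A, x *+ N = 0.
Local Notation L := (cyclotomic_field N).
Local Notation iota := (cyclotomicC N).
Implicit Type sigma : gal_of {: L}.

Lemma cyclo_expP sigma : sigma (zeta N) = zeta N ^+ cyclo_exp sigma.
Proof.
rewrite /cyclo_exp; case: pickP => [l /eqP-> //| no_l].
have [|l Dl] := @prim_rootP _ _ _ (zeta_prim N_gt0) (sigma (zeta N)).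
  by rewrite -rmorphXn (prim_expr_order (zeta_prim N_gt0)) rmorph1.
by have := no_l l; rewrite Dl eqxx.
Qed.

Lemma coprime_cyclo_exp sigma : coprime (cyclo_exp sigma) N.
Proof.
rewrite -(prim_root_exp_coprime _ (zeta_prim N_gt0)) -cyclo_expP.
by rewrite fmorph_primitive_root zeta_prim.
Qed.

Lemma etaE sigma (g : A) : Defs.eta sigma g = g *+ cyclo_exp sigma.
Proof. by apply: Zprod_eqP => i; rewrite Zprod_mkE Zprod_funMn. Qed.

Lemma eta_bij sigma : bijective (@Defs.eta r d N sigma).
Proof.
(* Bezout gives a with a l_sigma = -1 modulo N, hence the sign in the inverse map below. *)
have [a _] := Bezoutr (cyclo_exp sigma) N_gt0.
rewrite (eqP (coprime_cyclo_exp sigma)) => /dvdnP[q Dq].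
have mulaN (g : A) : g *+ (a * cyclo_exp sigma) = - g.
  by apply/eqP; rewrite -subr_eq0 opprK addrC -mulrS -add1n Dq mulnC mulrnA expA mul0rn.
exists (fun g : A => - (g *+ a)) => g; rewrite !etaE.
  by rewrite -mulrnA mulnC mulaN opprK.
by rewrite mulNrn -mulrnA mulaN opprK.
Qed.

(** With l = l_sigma, chi_{l v}(-g) = chi_v(-l g), and g -> l g permutes the group. *)
Lemma fourier_eta sigma v (a : gralg A) :
  fourier (Defs.eta sigma v) (gralg_mk (fun g => gralg_fun a (Defs.eta sigma g))) =
  fourier v a.
Proof.
rewrite [RHS](reindex (Defs.eta sigma)) /=; last exact/onW_bij/eta_bij.
apply: eq_bigr => g _; rewrite gralg_mkE; congr (_ * _).
by rewrite !etaE chiMnl // -mulNrn chiMn.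
Qed.

(** Character values are powers of omega_N, which sigma raises to the power l_sigma; the
    coefficients of [a] are rational, hence fixed. *)
Lemma gal_fourier v (a : gralg A) :
  exists y : L, iota y = fourier v a /\
    forall sigma, iota (sigma y) = fourier (Defs.eta sigma v) a.
Proof.
have chiL g : exists y : L, iota y = chi v (- g) /\
    forall sigma, iota (sigma y) = chi (Defs.eta sigma v) (- g).
  have [|m Dm] := @prim_rootP _ _ _ (omega_prim N_gt0) (chi v (- g)).
    by rewrite -chiMn // expA chi0.
  exists (zeta N ^+ m); split=> [|sigma]; first by rewrite rmorphXn /= zetaC Dm.
  by rewrite rmorphXn /= cyclo_expP exprAC rmorphXn rmorphXn /= zetaC -Dm etaE chiMnl.
have [y yP] := fin_all_exists chiL.
exists (\sum_g (gralg_fun a g)%:A * y g); split=> [|sigma].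
  rewrite rmorph_sum; apply: eq_bigr => g _.
  by rewrite rmorphM alg_num_field fmorph_rat (yP g).1.
rewrite !rmorph_sum; apply: eq_bigr => g _.
by rewrite !rmorphM alg_num_field !fmorph_rat (yP g).2.
Qed.

(** sigma sends the transform of [a] at v to that of [a] at eta_sigma(v), while the transform of a o
    eta_sigma at eta_sigma(v) is that of [a] at v. Hence all values are fixed exactly when [a] and a
    o eta_sigma have the same transform. *)
Lemma gal_fixed_fourier sigma (a : gralg A) (y : A -> L) :
    (forall v, iota (y v) = fourier v a) ->
  (forall v, sigma (y v) = y v) <->
  (forall g, gralg_fun a g = gralg_fun a (Defs.eta sigma g)).
Proof.
move=> yE; pose b := gralg_mk (fun g => gralg_fun a (Defs.eta sigma g)).
have iota_sigma v : iota (sigma (y v)) = fourier (Defs.eta sigma v) a.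
  have [z [zE sz]] := gal_fourier v a.
  by rewrite -sz; congr (iota (sigma _)); apply: (fmorph_inj iota); rewrite yE zE.
split=> [y_fix | a_fix v].
  suff ab : a = b by move=> g; rewrite {1}ab gralg_mkE.
  apply: (@fourier_inj _ _ d_gt0) => v.
  have [inv_eta _ etaK] := eta_bij sigma; rewrite -(etaK v) fourier_eta.
  by rewrite -iota_sigma y_fix yE.
have ab : a = b by apply/gralgP => g; rewrite gralg_mkE.
by apply: (fmorph_inj iota); rewrite iota_sigma yE {1}ab fourier_eta.
Qed.

Lemma mem_Gal_adjoin sigma (cs : seq L) :
  sigma \in 'Gal({: L} / <<1 & cs>>)%g <-> forall x, x \in cs -> sigma x = x.
Proof.
rewrite -sub1set galois_connection ?subvf //; split.
  case/Fadjoin_seqP=> _ cs_fixed x /cs_fixed /(fixedFieldP (memvf x)).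
  by apply; rewrite set11.
move=> cs_fixed; apply/Fadjoin_seqP; split; first exact: sub1v.
move=> x /cs_fixed Dx; apply/(fixedFieldP (memvf x)) => tau /set1P->; exact: Dx.
Qed.

Lemma galois_adjoin (K : {subfield L}) : galois K {: L}.
Proof.
rewrite /galois subvf normalFieldf andbT /=; apply/separableP => x _.
by apply: pcharf0_separable => p; rewrite pchar_lalg pchar_num.
Qed.

Section HGroup.
Variables (n : nat) (T : 'I_n -> 'I_n -> {set A}).
Local Notation H := (H_group N T).

(** Invariance of the beta_k under eta_sigma amounts to sigma fixing all their Fourier values, which
    are the coefficients of the P_v up to sign. *)
Lemma H_group_Gal :
  exists2 c : A * 'I_n -> L,
    forall v k, iota (c (v, k)) = fourier v (beta k.+1 (Delta T)) &
    H = 'Gal({: L} / <<1 & codom c>>)%g.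
Proof.
have c_ vk : exists y : L, iota y = fourier vk.1 (beta (vk.2 : 'I_n).+1 (Delta T)).
  by have [y [yE _]] := gal_fourier vk.1 (beta vk.2.+1 (Delta T)); exists y.
have [c cE] := fin_all_exists c_.
have {}cE k v : iota (c (v, k)) = fourier v (beta (k : 'I_n).+1 (Delta T)) := cE (v, k).
exists c => [v k|]; first exact: cE.
apply/setP => sigma; apply/idP/idP; last first.
  move/mem_Gal_adjoin=> c_fix; rewrite inE; apply/andP; split.
    by rewrite -sub1set galois_connection ?subvf ?sub1v.
  apply/'forall_forallP => k g; apply/eqP; move: g.
  apply/(gal_fixed_fourier sigma (cE k)) => v.
  by apply: c_fix; apply: codom_f.
rewrite inE => /andP[_ /'forall_forallP b_fix].
apply/mem_Gal_adjoin => _ /codomP[[v k] ->]; move: v.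
apply/(gal_fixed_fourier sigma (cE k)) => g.
exact/eqP/b_fix.
Qed.

Lemma char_poly_eta sigma v : sigma \in H ->
  char_poly (Delta_tilde T (chi (Defs.eta sigma v))) = char_poly (Delta_tilde T (chi v)).
Proof.
rewrite inE => /andP[_ /'forall_forallP b_fix]; apply/polyP => i.
have [lt_ni | le_in] := ltnP n i.
  by rewrite !nth_default // size_char_poly.
have lead1 (M : 'M[algC]_n) : (char_poly M)`_n = 1.
  by have /monicP := char_poly_monic M; rewrite lead_coefE size_char_poly.
(* Degree n is the leading coefficient 1; each lower degree n - k - 1 belongs to beta_{k+1}. *)
rewrite -(subKn le_in); case Dk: (n - i)%N => [|k]; first by rewrite subn0 !lead1.
have kn : (k < n)%N by rewrite -Dk leq_subr.
rewrite !coef_char_poly_Delta_tilde //; congr (_ * _).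
rewrite -[RHS](fourier_eta sigma); congr (fourier _ _).
by apply/gralgP => g; rewrite gralg_mkE; apply/eqP/(b_fix (Ordinal kn)).
Qed.
End HGroup.
End GaloisAction.

(** * The splitting field of the digraph and its degree *)

Lemma char_poly_split n (M : 'M[algC]_n) :
  {rs : seq algC | char_poly M = \prod_(z <- rs) ('X - z%:P)}.
Proof.
have [rs Drs] := closed_field_poly_normal (char_poly M).
by exists rs; rewrite Drs (monicP (char_poly_monic M)) scale1r.
Qed.

(** Up to sign the value is a coefficient of P_v, hence a polynomial in its roots. *)
Lemma subfield_fourier_beta (F : algC -> Prop) r (d : 'I_r -> nat) n
    (T : 'I_n -> 'I_n -> {set Zprod d}) v k :
    (forall i, (0 < d i)%N) -> is_subfield F -> (k <= n)%N ->
    (forall y, root (char_poly (Delta_tilde T (chi v))) y -> F y) ->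
  F (fourier v (beta k (Delta T))).
Proof.
move=> d_gt0 Fsub le_kn Froot; have [F1 FB _] := Fsub.
rewrite -[fourier _ _](signrMK k) -coef_char_poly_Delta_tilde //.
apply: subfieldM => //.
  rewrite -signr_odd; case: odd; rewrite ?expr0 // expr1 -sub0r.
  by apply: (FB) => //; rewrite -(subrr 1); apply: FB.
have [rs Drs] := char_poly_split (Delta_tilde T (chi v)).
rewrite Drs; apply: subfield_coef_prod_XsubC => // z rs_z.
by apply: Froot; rewrite Drs root_prod_XsubC.
Qed.

Lemma map_preimage (L : fieldExtType rat) (iota : {rmorphism L -> algC}) (s : seq algC) :
  (forall x, x \in s -> exists y, iota y = x) -> exists t, map iota t = s.
Proof.
elim: s => [|x s IHs] s_im; first by exists [::].
have [|t Dt] := IHs; first by move=> y sy; apply: s_im; rewrite inE sy orbT.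
by have [y Dy] := s_im x (mem_head x s); exists (y :: t); rewrite /= Dy Dt.
Qed.

Theorem theorem4p2
  (G0 : finGroupType) (S : {set G0}) (hS : 1%g \notin S)
  (G : {group G0}) (hG : abelian G)
  (n : nat) (hn : #|[set: G0] : G|%g = n)
  (r : nat) (d : 'I_r -> nat) (hd : forall i, (0 < d i)%N)
  (e : Zprod d -> G0) (he : identifies e G)
  (s : 'I_n -> G0)
  (hs : is_transversal [set s i | i : 'I_n] (lcosets G [set: G0]) [set: G0]) :
  let N := #|G| in
  let T := connection_set S e s in
  let H := H_group N T in
  let J := eta_orbits d H in
  let p := char_poly (adjmx (Cay S)) in
  forall v : {set Zprod d} -> Zprod d, (forall O, O \in J -> v O \in O) ->
  (forall x : algC,
     splitting_field p x <->
     adjoin (fun y => Inv H y \/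
               exists2 O, O \in J & root (char_poly (Delta_tilde T (chi (v O)))) y) x)
  /\ (totient N)%:R / #|H|%:R <= (splitting_degree p)%:R :> rat
  /\ (splitting_degree p)%:R <= ((n`!) ^ #|J|)%:R * ((totient N)%:R / #|H|%:R) :> rat.
Proof.
move=> N T H J p v vJ.
have N0 : (0 < N)%N := cardG_gt0 G.
have expA := identifies_exponent he : forall x : Zprod d, x *+ N = 0.
have [c cE HE] := H_group_Gal N0 hd expA T; rewrite -/H in HE.
pose q w := char_poly (Delta_tilde T (chi w)).
pose K0 := <<1 & codom c>>%AS.
have fixH : fixedField H = K0 by rewrite HE; apply/galois_fixedField/galois_adjoin.
have InvE y : Inv H y <-> exists2 z, z \in K0 & cyclotomicC N z = y.
  by rewrite /Inv fixH.
have rootE y : root (map_poly ratr p) y <-> exists w, root (q w) y.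
  exact: (root_char_poly_Cay S hn hd he hs).
(* P_w is constant on H-orbits, so the chosen representatives suffice. *)
have repr_root w y : root (q w) y -> exists2 O, O \in J & root (q (v O)) y.
  move=> qwy; pose O := [set Defs.eta sigma w | sigma in H].
  have JO : O \in J by apply: imset_f.
  exists O => //; have /imsetP[sigma Hsigma ->] := vJ O JO.
  by rewrite /q char_poly_eta.
have splitE x : splitting_field p x <->
    adjoin (fun y => Inv H y \/ exists2 O, O \in J & root (q (v O)) y) x.
  split; apply: adjoin_mono => y.
    move=> /rootE[w /repr_root qy] F _ FA; apply: FA; right; exact: qy.
  case=> [/InvE[z K0z <-] | [O _ qy]] F Fsub Fp; last by apply/Fp/rootE; exists (v O).
  apply: subfield_fieldExt K0z => // _ /codomP[[w k] ->].
  by rewrite cE; apply: subfield_fourier_beta => // y0 qy; apply/Fp/rootE; exists w.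
split=> //; pose E := numfield (complex_roots p).
pose kappa : {rmorphism E -> algC} := numfieldC (complex_roots p).
have imE x : splitting_field p x <-> exists y : E, kappa y = x.
  by apply: splitting_fieldP; rewrite monic_neq0 ?char_poly_monic.
have dimE : splitting_degree p = \dim {: E} by [].
have dimK0 : (\dim K0 * #|H|)%N = totient N.
  have galK0 := galois_adjoin K0.
  by rewrite HE -(galois_dim galK0) mulnC divnK ?field_dimS ?subvf ?dim_cyclotomic_field.
have -> : (totient N)%:R / #|H|%:R = (\dim K0)%:R :> rat.
  rewrite -dimK0 natrM mulfK // pnatr_eq0.
  by apply: contraTneq N0 => H0; rewrite -totient_gt0 -dimK0 H0 muln0.
rewrite -natrM !ler_nat dimE; split.
  apply: (dimv_le_image (i1 := cyclotomicC N) (i2 := kappa)) => x K0x.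
  have /imE[y Dy] : splitting_field p (cyclotomicC N x).
    by apply/splitE => F _ FA; apply: FA; left; apply/InvE; exists x.
  by exists y; rewrite ?memvf.
(* For the upper bound, K_0 is copied into E: [K] is generated by the preimages [c'] of its
   generators. *)
have c'_ wk : exists y : E, kappa y = cyclotomicC N (c wk).
  apply/imE/splitE => F _ FA; apply: FA; left; apply/InvE.
  by exists (c wk) => //; apply: seqv_sub_adjoin; apply: codom_f.
have [c' c'E] := fin_all_exists c'_.
pose K := <<1 & codom c'>>%AS.
(* The roots of P_{v(O)} pulled back to E; the empty list is a default outside J. *)
have rs_ O : exists rs : seq E,
    O \in J -> map_poly kappa (\prod_(x <- rs) ('X - x%:P)) = q (v O).
  case JO : (O \in J); last by exists [::].
  have [zs Dzs] := char_poly_split (Delta_tilde T (chi (v O))).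
  have [|rs Drs] := @map_preimage E kappa zs.
    move=> z zs_z; apply/imE => F _ FA; apply/FA/rootE.
    by exists (v O); rewrite /q Dzs root_prod_XsubC.
  exists rs => _; rewrite /q Dzs -Drs rmorph_prod big_map.
  by apply: eq_bigr => x _; rewrite /= map_polyXsubC.
have [rs rsE] := fin_all_exists rs_.
pose rss := [seq rs B | B <- enum J].
have rss_split rs1 : rs1 \in rss ->
    \prod_(x <- rs1) ('X - x%:P) \is a polyOver K /\ size rs1 = n.
  case/mapP=> O; rewrite mem_enum => JO ->; have Dq := rsE O JO.
  have sz_rs : size (rs O) = n.
    apply/eqP; rewrite -eqSS -(size_prod_XsubC _ id) -(size_map_poly kappa) Dq.
    by rewrite size_char_poly.
  split=> //; apply/polyOverP => i.
  have [lt_in | lt_ni | ->] := ltngtP i n; last 2 first.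
  - by rewrite nth_default ?rpred0 // size_prod_XsubC sz_rs.
  - have /monicP := monic_prod_XsubC (rs O) predT id.
    by rewrite lead_coefE size_prod_XsubC sz_rs => ->; rewrite rpred1.
  have [k Dk] : exists k, (n - i)%N = k.+1.
    by exists (n - i).-1; rewrite prednK // subn_gt0.
  have kn : (k < n)%N by rewrite -Dk leq_subr.
  have -> : (\prod_(x <- rs O) ('X - x%:P))`_i = (-1) ^+ k.+1 * c' (v O, Ordinal kn).
    apply: (fmorph_inj kappa); rewrite -coef_map Dq -(subKn (ltnW lt_in)) Dk.
    rewrite coef_char_poly_Delta_tilde // rmorphM rmorphXn rmorphN1.
    by rewrite c'E cE.
  by rewrite rpredM ?rpredX ?rpredN ?rpred1 // seqv_sub_adjoin ?codom_f.
have := dim_adjoin_flatten_roots rss_split; rewrite size_map -cardE => le_flat.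
have le_K : (\dim K <= \dim K0)%N.
  apply: (dimv_le_image (i1 := kappa) (i2 := cyclotomicC N)) => x Kx.
  apply: (subfield_fieldExt (subfield_image (cyclotomicC N) K0) _ Kx).
  move=> _ /codomP[wk ->]; exists (c wk); last by rewrite c'E.
  by apply: seqv_sub_adjoin; apply: codom_f.
apply: leq_trans (leq_trans le_flat _); last by rewrite leq_mul2l le_K orbT.
(* Every element of E maps into the splitting field, which by [splitE] lies in the image of [K] with
   the listed roots adjoined. *)
apply: (dimv_le_image (i1 := kappa) (i2 := kappa)) => x _.
have /imE/splitE kx : exists y, kappa y = kappa x by exists x.
apply: (kx _ (subfield_image kappa <<K & flatten rss>>%AS)).
move=> y [/InvE[z K0z <-] | [O JO qy]].
  apply: (subfield_fieldExt (subfield_image kappa <<K & flatten rss>>%AS) _ K0z).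
  move=> _ /codomP[wk ->]; exists (c' wk); last by rewrite c'E.
  apply: (subvP (subv_adjoin_seq _ _)).
  by apply: seqv_sub_adjoin; apply: codom_f.
have: root (map_poly kappa (\prod_(x <- rs O) ('X - x%:P))) y by rewrite rsE.
rewrite rmorph_prod (eq_bigr (fun z => 'X - (kappa z)%:P)); last first.
  by move=> z _; rewrite /= map_polyXsubC.
rewrite -(big_map kappa predT (fun z => 'X - z%:P)) root_prod_XsubC.
case/mapP=> z rs_z ->; exists z => //; apply: seqv_sub_adjoin.
by apply/flattenP; exists (rs O) => //; apply/mapP; exists O; rewrite ?mem_enum.
Qed.
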